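(* Let $n\ge 3$ be an integer and let $$p_n(t)=\big((n-1)-(n-2)t\big)\left(1+2t+3t^2+\cdots+(n-1)t^{n-2}\right).$$ Then the derivative $p_n'$ has exactly one zero $t_n$ in the interval $[0,1]$, this zero is the maximum point of $p_n$ on $[0,1]$, and the best constant $\lambda_n$ exists and equals $$\lambda_n=\frac{n^2}{1-\frac{n-1}{p_n(t_n)}}.$$
   Context: For an integer $n\ge 3$, the best constant $\lambda_n$ is the maximal real number $\lambda>0$ such that the inequality $$\sum_{i=1}^n\frac{1}{x_i}\ \ge\ \frac{\lambda}{1+n^{n-2}(\lambda-n^2)\prod_{i=1}^n x_i}$$ holds for all real $x_1,\ldots,x_n>0$ with $\sum_{i=1}^n x_i=1$. *)

(* Defs.v *)
From HB Require Import structures.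
From mathcomp Require Import all_boot all_order all_algebra.
From mathcomp Require Import all_classical all_reals all_analysis.

Set Implicit Arguments.
Unset Strict Implicit.
Unset Printing Implicit Defensive.

Import Order.TTheory GRing.Theory Num.Theory.
Import numFieldNormedType.Exports.

Local Open Scope classical_set_scope.
Local Open Scope ring_scope.

Definition p_ {R : realType} (n : nat) (t : R) : R :=
  ((n%:R - 1) - (n%:R - 2) * t) * \sum_(k < n.-1) k.+1%:R * t ^+ k.

(* The denominator is positive for every lambda > 0, since the product of the
   x i is at most n^-n; the totalized division is thus never by zero. *)
Definition admissible {R : realType} (n : nat) : set R :=
  [set lambda | 0 < lambda /\
    forall x : 'I_n -> R, (forall i, 0 < x i) -> \sum_(i < n) x i = 1 ->
      lambda / (1 + n%:R ^+ (n - 2) * (lambda - n%:R ^+ 2) * \prod_(i < n) x i)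
        <= \sum_(i < n) 1 / x i].

Definition is_best_constant {R : realType} (n : nat) (lambda : R) : Prop :=
  admissible n lambda /\ ubound (admissible n) lambda.

(* Main.v *)
Require Import Defs.
From HB Require Import structures.
From mathcomp Require Import all_boot all_order all_algebra.
From mathcomp Require Import all_classical all_reals all_analysis.
From mathcomp Require Import ring lra.

Set Implicit Arguments.
Unset Strict Implicit.
Unset Printing Implicit Defensive.

Import Order.TTheory GRing.Theory Num.Theory.
Import numFieldNormedType.Exports.

Local Open Scope classical_set_scope.
Local Open Scope ring_scope.

(** Clearing the denominator, which is positive, lambda is admissible iff
    S (1 + mu P) >= lambda on the open simplex, where S is the sum of the
    1 / x i, P is the product of the x i and mu = n^(n-2) (lambda - n^2).

    The test points have n - 1 coordinates t/n and one coordinate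
    (n - (n-1) t)/n.  There S (1 + mu P) - lambda is a positive multiple of
    (1 - t)^2 (n^2 p(t) - lambda (p(t) - (n-1))), with p short for p_ n
    ([objective_two_valued]): both S (1 - n^n P) and 1 - n^(n-2) P S vanish to
    second order at t = 1, and t (n - (n-1) t) / (1 - t)^2 times these quantities
    are n^2 p(t) and p(t) - (n-1).  Hence for 0 < t < 1 the test point forces
    lambda <= n^2 p(t) / (p(t) - (n-1)), a decreasing function of p(t); the
    strongest constraint comes from the maximum of p.

    Conversely, for mu > 0 a worst point is always a test point with
    0 < t <= 1.  A minimizer of S (1 + mu P) exists by compactness
    ([objective_has_min]).  Moving two of its coordinates with their sum s
    fixed makes the objective a convex function of their product q, so at the
    minimizer 1/x i + 1/x j >= K for all i <> j, with one common K, and equality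
    holds when x i <> x j ([minimizer_pair]): q can always be decreased, and it
    can be increased unless the two coordinates agree.  These relations leave at
    most one coordinate, the largest, different from the others
    ([minimizer_two_valued]).

    As for p itself, its derivative has positive coefficients except for the
    leading one, so it changes sign at most once on the positive axis
    ([one_sign_change_gt0]); it is positive at 0 and negative at 1. *)

(** * The polynomial p_n *)

Definition weighted_sum {R : realType} (m : nat) (t : R) : R :=
  \sum_(k < m) k.+1%:R * t ^+ k.

Lemma weighted_sumS (R : realType) (m : nat) (t : R) :
  weighted_sum m.+1 t = weighted_sum m t + m.+1%:R * t ^+ m.
Proof. by rewrite /weighted_sum big_ord_recr. Qed.

Lemma p_E (R : realType) (m : nat) (t : R) :
  p_ m.+2 t = (m.+1%:R - m%:R * t) * weighted_sum m.+1 t.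
Proof. by rewrite /p_; congr (_ * _); rewrite -!natr1; ring. Qed.

(** The weighted sum is the derivative of a geometric sum; this is its closed form
    with the double root at 1 kept as a factor. *)
Lemma weighted_sum_closed (R : realType) (m : nat) (t : R) :
  (1 - t) ^+ 2 * weighted_sum m t = 1 - m.+1%:R * t ^+ m + m%:R * t ^+ m.+1.
Proof.
elim: m => [|m IH]; first by rewrite /weighted_sum big_ord0; ring.
by rewrite weighted_sumS mulrDr IH !exprS -!natr1; ring.
Qed.

Lemma weighted_sum_gt0 (R : realType) (m : nat) (t : R) :
  0 <= t -> 0 < weighted_sum m.+1 t.
Proof.
move=> t0; rewrite /weighted_sum big_ord_recl expr0 mulr1 ltr_pwDl //.
by apply: sumr_ge0 => k _; rewrite mulr_ge0 ?exprn_ge0.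
Qed.

(** The closed form of [weighted_sum] cancels everything but a multiple of
    [weighted_sum m], which is the quotient of 1 - n^(n-2) P S by (1 - t)^2 at the
    test points; this is how p_n - (n-1) enters the best constant. *)
Lemma p_sub (R : realType) (m : nat) (t : R) :
  p_ m.+2 t - m.+1%:R = t * (m.+2%:R - m.+1%:R * t) * weighted_sum m t.
Proof.
rewrite p_E weighted_sumS.
have := weighted_sum_closed m t; set Q := weighted_sum m t => E.
apply/eqP; rewrite -subr_eq0; apply/eqP.
transitivity (m.+1%:R * ((1 - t) ^+ 2 * Q -
   (1 - m.+1%:R * t ^+ m + m%:R * t ^+ m.+1))).
  by rewrite [t ^+ m.+1]exprS -!natr1; ring.
by rewrite E subrr mulr0.
Qed.

(** With c = m and j = m this expands p_(m+2) in powers of t; a free c makes the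
    identity provable by induction on j. *)
Lemma linear_mul_weighted_sum (R : realType) (c : R) (j : nat) (t : R) :
  ((c + 1) - c * t) * weighted_sum j.+1 t =
  (c + 1) + \sum_(k < j) (c + 2 + k%:R) * t ^+ k.+1 - c * j.+1%:R * t ^+ j.+1.
Proof.
elim: j => [|j IH].
  by rewrite /weighted_sum big_ord_recl !big_ord0 /= expr0; ring.
by rewrite weighted_sumS mulrDr IH big_ord_recr /= !exprS -!natr1; ring.
Qed.

(** p_(m+2) as a formal polynomial, which gives access to formal derivation. *)
Definition p_poly (R : realType) (m : nat) : {poly R} :=
  (m.+1%:R)%:P + \sum_(k < m) (m%:R + 2 + k%:R) *: 'X^(k.+1)
  - (m%:R * m.+1%:R) *: 'X^(m.+1).

Lemma p_polyE (R : realType) (m : nat) : p_ m.+2 = horner (p_poly R m).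
Proof.
apply/funext => t; rewrite p_E -[m.+1%:R as X in X - _]natr1 linear_mul_weighted_sum.
rewrite /p_poly hornerD hornerN hornerD hornerC hornerZ hornerXn horner_sum natr1.
by under [in RHS]eq_bigr do rewrite hornerZ hornerXn.
Qed.

Lemma expr_cross_le (R : realType) (s t : R) (k m : nat) :
  0 <= s <= t -> (k <= m)%N -> t ^+ k * s ^+ m <= s ^+ k * t ^+ m.
Proof.
move=> /andP[s0 st] /subnKC <-; have t0 := le_trans s0 st.
rewrite !exprD mulrCA ler_wpM2l ?exprn_ge0 // ler_wpM2l ?exprn_ge0 //.
by rewrite lerXn2r.
Qed.

(** For positive [a] and [c], a polynomial whose coefficients change sign once;
    the derivative of p_n has this shape. *)
Definition one_sign_change (R : realType) (a : nat -> R) (c : R) (m : nat) (t : R) :=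
  \sum_(k < m) a k * t ^+ k - c * t ^+ m.

(** Divided by t^(m+1), the polynomial is strictly decreasing in t, because every
    a k t^k / t^(m+1) is; compared after cross-multiplication, so that s = 0 is
    covered. *)
Lemma one_sign_change_gt0 (R : realType) (a : nat -> R) (c : R) (m : nat) (s t : R) :
  (forall k, 0 < a k) -> 0 <= s -> s < t ->
  0 <= one_sign_change a c m.+1 t -> 0 < one_sign_change a c m.+1 s.
Proof.
move=> a0 s0 st qt; have t0 : 0 < t := le_lt_trans s0 st.
rewrite -(pmulr_lgt0 _ (exprn_gt0 m.+1 t0)).
apply: (le_lt_trans (mulr_ge0 qt (exprn_ge0 m.+1 s0))).
rewrite /one_sign_change -subr_gt0.
rewrite (_ : _ - _ = \sum_(k < m.+1) a k * (s ^+ k * t ^+ m.+1 - t ^+ k * s ^+ m.+1)).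
  rewrite big_ord_recl !expr0 !mul1r ltr_pwDl //.
    by rewrite mulr_gt0 // subr_gt0 ltrXn2r // nnegrE ltW.
  apply: sumr_ge0 => k _; rewrite mulr_ge0 ?(ltW (a0 _)) // subr_ge0.
  by apply: expr_cross_le; [rewrite s0 ltW|exact: ltnW].
rewrite !mulrBl !mulr_suml opprB addrACA -!sumrN.
under [RHS]eq_bigr do rewrite mulrBr.
rewrite sumrB.
have -> : c * t ^+ m.+1 * s ^+ m.+1 = c * s ^+ m.+1 * t ^+ m.+1 by ring.
rewrite sumrN.
under eq_bigr do rewrite -mulrA.
under [X in _ - X]eq_bigr do rewrite -mulrA.
by ring.
Qed.

Lemma p_derive (R : realType) (m : nat) (t : R) :
  derive1 (p_ m.+2) t =
  one_sign_change (fun k => k.+1%:R * (m%:R + 2 + k%:R)) (m%:R * m.+1%:R ^+ 2) m t.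
Proof.
rewrite p_polyE -derivE /p_poly /one_sign_change derivB derivD derivC add0r derivZ derivXn.
rewrite raddf_sum hornerD hornerN horner_sum hornerZ hornerMn hornerXn /=; congr (_ - _).
  by apply: eq_bigr => k _; rewrite derivZ derivXn /= hornerZ hornerMn hornerXn -mulr_natl; ring.
by rewrite -mulr_natl; ring.
Qed.

Lemma sum_derive_coef (R : realType) (c : R) (j : nat) :
  6 * (\sum_(k < j) k.+1%:R * (c + k%:R)) =
  3 * j%:R * j.+1%:R * c + 2 * (j%:R - 1) * j%:R * j.+1%:R.
Proof.
elim: j => [|j IH]; first by rewrite big_ord0; ring.
by rewrite big_ord_recr /= mulrDr IH -!natr1; ring.
Qed.

(** The value is - n (n-1) (n-2) / 6 with n = m + 3. *)
Lemma p_derive_at1_lt0 (R : realType) (m : nat) : derive1 (@p_ R m.+3) 1 < 0.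
Proof.
rewrite p_derive /one_sign_change expr1n mulr1.
under eq_bigr do rewrite expr1n mulr1.
rewrite -(pmulr_rlt0 _ (_ : 0 < 6 :> R)) // mulrBr sum_derive_coef -!natr1.
have := ler0n R m; set x : R := m%:R => x0.
rewrite (_ : _ - _ = - ((x + 1) * (x + 2) * (x + 3))); last by ring.
by rewrite oppr_lt0 !mulr_gt0 //; lra.
Qed.

Lemma p_critical_point (R : realType) (m : nat) :
  exists2 t : R, 0 < t < 1 & derive1 (p_ m.+3) t = 0.
Proof.
have d0 : 0 < derive1 (@p_ R m.+3) 0.
  rewrite p_derive /one_sign_change expr0n mulr0 subr0 big_ord_recl expr0 mulr1.
  rewrite big1 ?addr0; last by move=> k _; rewrite expr0n mulr0.
  by rewrite mul1r ltr_wpDr // ltr_wpDl.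
have d1 := p_derive_at1_lt0 R m.
have [||t] := @IVT R (derive1 (p_ m.+3)) 0 1 0 ler01.
- by apply: continuous_subspaceT; rewrite p_polyE -derivE; exact: continuous_horner.
- by rewrite ge_min le_max (ltW d0) (ltW d1) orbT.
rewrite in_itv /= => /andP[t0 t1] dt; exists t => //.
rewrite !lt_neqAle t0 t1 !andbT; apply/andP; split.
  by apply: contra_eq_neq dt => <-; rewrite gt_eqF.
by apply: contra_eq_neq dt => ->; rewrite lt_eqF.
Qed.

Lemma p_derive_gt0 (R : realType) (m : nat) (s t : R) :
  0 <= s -> s < t -> 0 <= derive1 (p_ m.+3) t -> 0 < derive1 (p_ m.+3) s.
Proof.
by rewrite !p_derive => s0 st; apply: one_sign_change_gt0.
Qed.

(** By [p_derive_gt0], p increases before a zero of its derivative and decreases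
    after it; the comparison with t is then the mean value theorem. *)
Lemma p_lt_critical (R : realType) (m : nat) (s t : R) :
  0 < t -> derive1 (p_ m.+3) t = 0 -> 0 <= s -> s != t -> p_ m.+3 s < p_ m.+3 t.
Proof.
move=> t0 dt s0; have pc : continuous (@p_ R m.+3).
  by rewrite p_polyE; exact: continuous_horner.
have pd (x : R) : is_derive x 1 (@p_ R m.+3) (derive1 (p_ m.+3) x).
  by rewrite p_polyE derive1E; apply: derivableP; exact: derivable_horner.
have mvt (a b : R) : a < b -> exists2 c, c \in `]a, b[ &
    p_ m.+3 b - p_ m.+3 a = derive1 (p_ m.+3) c * (b - a).
  by move=> ab; apply: MVT => //; exact: continuous_subspaceT.
rewrite neq_lt => /orP[] st; have [c] := mvt _ _ st; rewrite in_itv /= => /andP[c1 c2] e.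
- rewrite -subr_gt0 e mulr_gt0 ?subr_gt0 //.
  by apply: (@p_derive_gt0 _ _ _ t); rewrite ?dt // (le_trans s0) // ltW.
- rewrite -subr_lt0 e pmulr_llt0 ?subr_gt0 // ltNge; apply/negP => /(p_derive_gt0 (ltW t0) c1).
  by rewrite dt ltxx.
Qed.

(** * The objective at points with all but one coordinate equal *)

Definition objective {R : realType} (n : nat) (mu : R) (x : 'I_n -> R) : R :=
  (\sum_i 1 / x i) * (1 + mu * \prod_i x i).

Lemma big_two_valued (R : realType) (m : nat) (x : 'I_m.+2 -> R) (i0 : 'I_m.+2) (a : R) :
  (forall i, i != i0 -> x i = a) ->
  [/\ \sum_i x i = x i0 + m.+1%:R * a,
      \sum_i 1 / x i = 1 / x i0 + m.+1%:R * (1 / a)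
    & \prod_i x i = x i0 * a ^+ m.+1].
Proof.
move=> xa; have card : #|[pred i | i != i0]| = m.+1.
  by have := cardC1 i0; rewrite card_ord.
split; rewrite (bigD1 i0) //=; congr (_ _ _).
- by rewrite (eq_bigr (fun=> a)) // sumr_const card mulr_natl.
- by rewrite (eq_bigr (fun=> 1 / a)) ?sumr_const ?card ?mulr_natl // => i /xa ->.
- by rewrite (eq_bigr (fun=> a)) // prodr_const card.
Qed.

(** For d = n - (n-1) t these points have S = n^2 ((n-1) - (n-2) t) / (t d) and
    n^n P = d t^(n-1), so that 1 - n^n P and 1 - n^(n-2) P S are the closed forms
    of (1 - t)^2 times a [weighted_sum]. *)
Lemma objective_two_valued (R : realType) (m : nat) (lambda t : R)
    (x : 'I_m.+2 -> R) (i0 : 'I_m.+2) :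
  0 < t -> 0 < m.+2%:R - m.+1%:R * t ->
  (forall i, i != i0 -> x i = t / m.+2%:R) -> \sum_i x i = 1 ->
  objective (m.+2%:R ^+ m * (lambda - m.+2%:R ^+ 2)) x - lambda =
  (1 - t) ^+ 2 / (t * (m.+2%:R - m.+1%:R * t)) *
  (m.+2%:R ^+ 2 * p_ m.+2 t - lambda * (p_ m.+2 t - m.+1%:R)).
Proof.
move=> t0 d0 xa; have [-> Sx Px] := big_two_valued xa.
rewrite /objective Sx Px p_sub p_E.
have := weighted_sum_closed m.+1 t; have := weighted_sum_closed m t.
set Q0 := weighted_sum m t; set Q1 := weighted_sum m.+1 t.
rewrite exprMn exprVn !exprS !expr0; set X := t ^+ m.
have Nn : m.+1%:R = m.+2%:R - 1 :> R by rewrite -!natr1; ring.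
have Nm : m%:R = m.+2%:R - 2 :> R by rewrite -!natr1; ring.
have N0 : m.+2%:R != 0 :> R by rewrite pnatr_eq0.
rewrite Nn Nm in d0 *; set N : R := m.+2%:R in d0 N0 *.
move=> E0 E1 /(canRL (addrK _)) ->.
have -> : 1 - (N - 1) * (t / N) = (N - (N - 1) * t) / N by field.
set d := N - (N - 1) * t in d0 *.
have NX : N ^+ m != 0 by rewrite expf_neq0.
have [d1 t1] : d != 0 /\ t != 0 by rewrite !gt_eqF.
(* Displays the two products that E0 and E1 turn into polynomials in t and t ^+ m. *)
transitivity (((1 - t) * ((1 - t) * 1) * Q1) * (N ^+ 2 * ((N - 1) - (N - 2) * t)) / (t * d)
   - lambda * ((1 - t) * ((1 - t) * 1) * Q0)); last by field; rewrite d1 t1.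
rewrite E0 E1; move: (N ^+ m) NX => Y NX.
clearbody N; rewrite /d; field.
by rewrite -/d d1 t1 NX.
Qed.

(** * Minimizers of the objective *)

(** The objective bounds each 1 / x i, so the points that do at least as well as
    [x0], whose value is M, lie in a compact piece of the simplex where every
    coordinate is at least 1 / M. *)
Lemma objective_has_min (R : realType) (n : nat) (mu : R) (x0 : 'I_n -> R) :
  0 < mu -> (forall i, 0 < x0 i) -> \sum_i x0 i = 1 ->
  exists x : 'I_n -> R, [/\ forall i, 0 < x i, \sum_i x i = 1 &
    forall y : 'I_n -> R, (forall i, 0 < y i) -> \sum_i y i = 1 ->
      objective mu x <= objective mu y].
Proof.
move=> mu0 x0p x0s.
have recip_le (y : 'I_n -> R) i : (forall j, 0 < y j) -> 1 / y i <= objective mu y.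
  move=> yp; rewrite /objective; have P0 : 0 < \prod_j y j by apply: prodr_gt0 => j _.
  have S0 : 0 <= \sum_j 1 / y j by apply: sumr_ge0 => j _; rewrite divr_ge0 // ltW.
  apply: (@le_trans _ _ (\sum_j 1 / y j)).
    by rewrite (bigD1 i) //= lerDl sumr_ge0 // => j _; rewrite divr_ge0 // ltW.
  by rewrite ler_peMr // lerDl mulr_ge0 // ltW.
set M := objective mu x0.
have M0 : 0 < M.
  case: n x0 x0p x0s @M recip_le => [x0 _|n x0 x0p _ M recip_le].
    by rewrite big_ord0 => /eqP; rewrite eq_sym oner_eq0.
  by apply: lt_le_trans (recip_le x0 ord0 x0p); rewrite divr_gt0.
pose K := [set v : 'rV[R]_n | forall i, `[M^-1, 1]%classic (v ord0 i)] `&`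
          [set v : 'rV[R]_n | \sum_i v ord0 i = 1].
have sum_cont : continuous (fun v : 'rV[R]_n => \sum_i v ord0 i).
  by apply: continuous_big => [|i _]; [exact: add_continuous|exact: coord_continuous].
have cK : compact K.
  apply: compact_closedI.
    by apply: (@rV_compact _ _ (fun=> `[M^-1, 1]%classic)) => i; exact: segment_compact.
  apply: (@preimage_closed _ _ (fun v : 'rV[R]_n => \sum_i v ord0 i) [set y | y = 1]).
    by move=> v _; exact: sum_cont.
  exact: closed_eq.
have in_K (y : 'I_n -> R) : (forall i, 0 < y i) -> \sum_i y i = 1 ->
    objective mu y <= M -> K (\row_i y i).
  move=> yp ys yM; split => /=; last by under eq_bigr do rewrite mxE.
  move=> i; rewrite mxE in_itv /=; apply/andP; split.
    rewrite invf_ple ?posrE // -div1r; exact: le_trans (recip_le _ _ yp) yM.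
  rewrite -ys (bigD1 i) //= lerDl sumr_ge0 // => j _; exact: ltW.
have cont : {within K, continuous (fun v : 'rV[R]_n => objective mu (v ord0))}.
  apply: continuous_in_subspaceT => v; rewrite inE => -[vK _].
  have S_cvg : \sum_i 1 / (w ord0 i) @[w --> v] --> \sum_i 1 / v ord0 i.
    apply: (@cvg_big _ _ +%R) => [|i _]; first exact: add_continuous.
    apply: cvgM; first exact: cvg_cst.
    apply: cvgV; last exact: coord_continuous.
    have := vK i; rewrite /= in_itv /= => /andP[Mv _].
    by rewrite gt_eqF // (lt_le_trans _ Mv) // invr_gt0.
  have P_cont : continuous (fun w : 'rV[R]_n => \prod_i w ord0 i).
    by apply: continuous_big => [|i _]; [exact: mul_continuous|exact: coord_continuous].
  have T_cvg : 1 + mu * \prod_i (w ord0 i) @[w --> v] --> 1 + mu * \prod_i v ord0 i.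
    apply: cvgD; first exact: cvg_cst.
    by apply: cvgM; [exact: cvg_cst|exact: P_cont].
  exact: (cvgM S_cvg T_cvg).
have [|v vK vmin] := EVT_min_rV _ cK cont.
  by exists (\row_i x0 i); exact: in_K.
move: vK; rewrite inE => -[vK vs]; exists (v ord0); split => //.
  move=> i; have := vK i; rewrite /= in_itv /= => /andP[Mv _].
  by rewrite (lt_le_trans _ Mv) // invr_gt0.
move=> y yp ys.
have row_obj (z : 'I_n -> R) : objective mu ((\row_i z i) ord0) = objective mu z.
  rewrite /objective; congr (_ * (_ + _ * _)); apply: eq_bigr => i _; by rewrite mxE.
have [yM|/ltW My] := leP (objective mu y) M.
  by rewrite -(row_obj y); apply: vmin; rewrite inE; exact: in_K.
by apply: le_trans My; rewrite /M -(row_obj x0); apply: vmin; rewrite inE; exact: in_K.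
Qed.

Lemma exists_sum_prod (R : realType) (s q : R) :
  0 < s -> 0 < q -> 4 * q <= s ^+ 2 ->
  exists a b : R, [/\ 0 < a, 0 < b, a + b = s & a * b = q].
Proof.
move=> s0 q0 qs; set r := Num.sqrt (s ^+ 2 - 4 * q).
have r2 : r ^+ 2 = s ^+ 2 - 4 * q by rewrite sqr_sqrtr // subr_ge0.
have r0 : 0 <= r := sqrtr_ge0 _.
have rs : r < s by rewrite -(@ltr_pXn2r _ 2) ?nnegrE ?(ltW s0) // r2; lra.
exists ((s + r) / 2), ((s - r) / 2); split; [lra|lra|lra|].
have -> : (s + r) / 2 * ((s - r) / 2) = (s ^+ 2 - r ^+ 2) / 4 by field.
by rewrite r2; field.
Qed.

(** The function of q being minimized has derivative C S - s / q^2.  The point q0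
    may lie at the end s^2/4 of the allowed range, in which case only the
    direction of decreasing q gives information. *)
Lemma mixing_bound (R : realType) (s q0 S C : R) :
  0 < s -> 0 < q0 -> 4 * q0 <= s ^+ 2 -> 0 <= S -> 0 < C ->
  (forall q, 0 < q -> 4 * q <= s ^+ 2 ->
     (S + s / q0) * (1 + C * q0) <= (S + s / q) * (1 + C * q)) ->
  C * S * q0 ^+ 2 <= s /\ (4 * q0 < s ^+ 2 -> C * S * q0 ^+ 2 = s).
Proof.
move=> s0 p0 ps S0 C0 mn; have D0 : 0 <= C * S by rewrite mulr_ge0 // ltW.
set D := C * S in D0 *.
have key q : 0 < q -> 4 * q <= s ^+ 2 -> 0 <= (q - q0) * (D * (q0 * q) - s).
  move=> q1 qs; have := mn q q1 qs; rewrite -subr_ge0.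
  have -> : (S + s / q) * (1 + C * q) - (S + s / q0) * (1 + C * q0) =
      (q - q0) * (D * (q0 * q) - s) / (q0 * q).
    by rewrite /D; field; rewrite !gt_eqF.
  by rewrite pmulr_lge0 // invr_gt0 mulr_gt0.
have le : D * q0 ^+ 2 <= s.
  rewrite leNgt; apply/negP => lt.
  have D1 : 0 < D by rewrite lt_neqAle D0 andbT; apply: contraTneq lt => <-; rewrite mul0r -leNgt ltW.
  (* The difference of values at q and q0 has the sign of
     (q - q0) (D q0 q - s), hence is negative for q between s / (D q0) and q0. *)
  set q := (q0 + s / (D * q0)) / 2.
  have Dq : 0 < D * q0 by rewrite mulr_gt0.
  have lt2 : s / (D * q0) < q0 by rewrite ltr_pdivrMr // mulrC -mulrA -expr2.
  have q1 : 0 < s / (D * q0) by rewrite divr_gt0.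
  have qq : q < q0 by rewrite /q; lra.
  have := key q; rewrite nmulr_rge0 ?subr_lt0 // subr_le0.
  have -> : D * (q0 * q) = (D * q0 ^+ 2 + s) / 2 by rewrite /q; field; rewrite !gt_eqF.
  have qp : 0 < q by rewrite /q; lra.
  by move=> /(_ qp); lra.
split=> // lt4; apply/eqP; rewrite eq_le le /= leNgt; apply/negP => lt.
(* A step to the right that stays below s^2/4 and keeps D q0 (q0 + e) < s. *)
set e := Num.min (s ^+ 2 / 4 - q0) ((s - D * q0 ^+ 2) / (D * q0 + 1)).
have Dq : 0 < D * q0 + 1 by rewrite ltr_wpDl // mulr_ge0 // ltW.
have e0 : 0 < e.
  by rewrite lt_min; apply/andP; split; [lra|rewrite divr_gt0 // subr_gt0].
have e1 : e <= s ^+ 2 / 4 - q0 by rewrite ge_min lexx.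
have e2 : e * (D * q0 + 1) <= s - D * q0 ^+ 2.
  by rewrite -ler_pdivlMr // ge_min lexx orbT.
have := key (q0 + e); rewrite addrAC subrr add0r pmulr_rge0 //.
move=> /(_ (addr_gt0 p0 e0)) h; have {h} : 0 <= D * (q0 * (q0 + e)) - s by apply: h; lra.
rewrite leNgt; apply/negPn; move: e2.
have -> : D * (q0 * (q0 + e)) - s = D * q0 ^+ 2 - s + e * (D * q0 + 1) - e by ring.
by lra.
Qed.

(** K is what [mixing_bound] yields once expressed with the full sum and product,
    which makes it independent of the pair. *)
Lemma minimizer_pair (R : realType) (n : nat) (mu : R) (x : 'I_n -> R) (i j : 'I_n) :
  0 < mu -> (forall k, 0 < x k) -> \sum_k x k = 1 ->
  (forall y : 'I_n -> R, (forall k, 0 < y k) -> \sum_k y k = 1 ->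
     objective mu x <= objective mu y) ->
  j != i ->
  let K := mu * (\prod_k x k) * (\sum_k 1 / x k) / (1 + mu * \prod_k x k) in
  K <= 1 / x i + 1 / x j /\ (x i != x j -> 1 / x i + 1 / x j = K).
Proof.
move=> mu0 xp xs xmin ij K.
have split_sum (F : 'I_n -> R) :
    \sum_k F k = F i + (F j + \sum_(k | (k != i) && (k != j)) F k).
  by rewrite (bigD1 i) //= (bigD1 j).
have split_prod (F : 'I_n -> R) :
    \prod_k F k = F i * (F j * \prod_(k | (k != i) && (k != j)) F k).
  by rewrite (bigD1 i) //= (bigD1 j).
set P' := \prod_(k | (k != i) && (k != j)) x k.
set S' := \sum_(k | (k != i) && (k != j)) 1 / x k.
set s := x i + x j; set q0 := x i * x j.
have P0 : 0 < P' by apply: prodr_gt0.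
have S0 : 0 <= S' by apply: sumr_ge0 => k _; rewrite divr_ge0 // ltW.
have s0 : 0 < s by rewrite addr_gt0.
have p0 : 0 < q0 by rewrite mulr_gt0.
have C0 : 0 < mu * P' by rewrite mulr_gt0.
have disc : s ^+ 2 - 4 * q0 = (x i - x j) ^+ 2 by rewrite /s /q0; ring.
have ps : 4 * q0 <= s ^+ 2 by rewrite -subr_ge0 disc sqr_ge0.
have Sx : \sum_k 1 / x k = S' + s / q0.
  by rewrite split_sum -/S' /s /q0; field; rewrite !gt_eqF.
have Px : \prod_k x k = P' * q0 by rewrite split_prod -/P' /q0; ring.
have mn q : 0 < q -> 4 * q <= s ^+ 2 ->
    (S' + s / q0) * (1 + (mu * P') * q0) <= (S' + s / q) * (1 + (mu * P') * q).
  move=> q1 qs; have [a [b [a0 b0 abs abq]]] := exists_sum_prod s0 q1 qs.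
  pose y k := if k == i then a else if k == j then b else x k.
  have yi : y i = a by rewrite /y eqxx.
  have yj : y j = b by rewrite /y (negPf ij) eqxx.
  have yk k : (k != i) && (k != j) -> y k = x k.
    by rewrite /y => /andP[/negPf-> /negPf->].
  have yp k : 0 < y k by rewrite /y; case: ifP => // _; case: ifP.
  have ys : \sum_k y k = 1.
    rewrite -xs !split_sum yi yj (eq_bigr _ yk) !addrA abs; congr (_ + _).
  have := xmin y yp ys; rewrite /objective Sx Px.
  have -> : \sum_k 1 / y k = S' + s / q.
    rewrite split_sum yi yj (eq_bigr (fun k => 1 / x k)); last by move=> k /yk ->.
    by rewrite -/S' -abs -abq; field; rewrite !gt_eqF.
  have -> : \prod_k y k = P' * q.
    by rewrite split_prod yi yj (eq_bigr _ yk) -/P' -abq; ring.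
  by rewrite !mulrA.
have [le eq] := mixing_bound s0 p0 ps S0 C0 mn.
have D0 : 0 < q0 * (1 + mu * P' * q0) by rewrite mulr_gt0 // addr_gt0 // mulr_gt0.
have KE : 1 / x i + 1 / x j - K = (s - mu * P' * S' * q0 ^+ 2) / (q0 * (1 + mu * P' * q0)).
  have -> : 1 / x i + 1 / x j = s / q0 by rewrite /s /q0; field; rewrite !gt_eqF.
  rewrite /K Sx Px mulrA; field.
  by move: D0; rewrite (pmulr_rgt0 _ p0) => D1; rewrite !gt_eqF.
split; first by rewrite -subr_ge0 KE divr_ge0 ?subr_ge0 // ltW.
move=> xij; apply/eqP; rewrite -subr_eq0 KE eq ?subrr ?mul0r //.
by rewrite -subr_gt0 disc lt_neqAle sqr_ge0 eq_sym sqrf_eq0 subr_eq0 xij.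
Qed.

(** Let [i0] be an index of a largest coordinate.  If x i < x j for two other
    indices, then 1/x i + 1/x j = K = 1/x i + 1/x i0, so x j = x i0 > x i and
    1/x j + 1/x i0 < 1/x i + 1/x i0 = K, against the inequality for the pair j, i0. *)
Lemma minimizer_two_valued (R : realType) (n : nat) (mu : R) (x : 'I_n.+1 -> R) :
  0 < mu -> (forall k, 0 < x k) -> \sum_k x k = 1 ->
  (forall y : 'I_n.+1 -> R, (forall k, 0 < y k) -> \sum_k y k = 1 ->
     objective mu x <= objective mu y) ->
  exists2 i0, forall i, x i <= x i0 &
    forall i j, i != i0 -> j != i0 -> x i = x j.
Proof.
move=> mu0 xp xs xmin.
have [i0 _ i0max] := @arg_maxP _ _ _ ord0 xpredT x isT.
exists i0 => [i|]; first exact: i0max.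
have not_lt i j : i != i0 -> j != i0 -> x i < x j -> False.
  move=> ii jj ij.
  have nij : j != i by apply: contraTneq ij => ->; rewrite ltxx.
  have im : x i < x i0 by apply: lt_le_trans ij (i0max j isT).
  have [_ Eij] := minimizer_pair mu0 xp xs xmin nij.
  rewrite eq_sym in ii; have [_ Eim] := minimizer_pair mu0 xp xs xmin ii.
  rewrite eq_sym in jj; have [Kjm _] := minimizer_pair mu0 xp xs xmin jj.
  move: Eij Eim Kjm; rewrite !lt_eqF // => /(_ isT) Eij /(_ isT) Eim.
  have : 1 / x i0 < 1 / x i by rewrite !div1r ltf_pV2 ?posrE.
  by lra.
move=> i j ii jj; case: (ltgtP (x i) (x j)) => // h; exfalso.
  exact: not_lt h.
exact: not_lt h.
Qed.

(** * The best constant *)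

(** It suffices to look at a minimizer, which is a test point; as its exceptional
    coordinate is the largest one, its parameter satisfies t <= 1. *)
Lemma objective_ge (R : realType) (m : nat) (lambda : R) (x : 'I_m.+3 -> R) :
  m.+3%:R ^+ 2 < lambda ->
  (forall s : R, 0 < s <= 1 ->
     lambda * (p_ m.+3 s - m.+2%:R) <= m.+3%:R ^+ 2 * p_ m.+3 s) ->
  (forall i, 0 < x i) -> \sum_i x i = 1 ->
  lambda <= objective (m.+3%:R ^+ m.+1 * (lambda - m.+3%:R ^+ 2)) x.
Proof.
move=> ln lp xp xs; set mu := _ * _.
have n0 : 0 < m.+3%:R :> R by rewrite ltr0n.
have mu0 : 0 < mu by rewrite mulr_gt0 ?exprn_gt0 // subr_gt0.
have [y [yp ys ymin]] := objective_has_min mu0 xp xs.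
apply: le_trans (ymin x xp xs).
have [i0 ymax yeq] := minimizer_two_valued mu0 yp ys ymin.
pose t := m.+3%:R * y (lift i0 ord0).
have ya i : i != i0 -> y i = t / m.+3%:R.
  move=> ii; rewrite /t mulrC mulKf ?gt_eqF //; apply: yeq => //.
  by rewrite eq_sym neq_lift.
have t0 : 0 < t by rewrite mulr_gt0.
have [Sy _ _] := big_two_valued ya.
have yi0 : m.+3%:R * y i0 = m.+3%:R - m.+2%:R * t.
  move: Sy; rewrite ys => /esym/(canRL (addrK _)) ->.
  by field; rewrite gt_eqF.
have d0 : 0 < m.+3%:R - m.+2%:R * t by rewrite -yi0 mulr_gt0.
have t1 : t <= 1.
  have := ymax (lift i0 ord0); rewrite -(ler_pM2l n0) yi0 -/t -subr_ge0.
  have -> : m.+3%:R - m.+2%:R * t - t = m.+3%:R * (1 - t) by rewrite -!natr1; ring.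
  by rewrite pmulr_rge0 // subr_ge0.
rewrite -subr_ge0 (objective_two_valued _ t0 d0 ya ys).
by rewrite mulr_ge0 ?divr_ge0 ?sqr_ge0 ?subr_ge0 ?lp ?t0 // ltW // mulr_gt0.
Qed.

(** The inequality defining admissibility, read at the test point of parameter t. *)
Lemma admissible_le (R : realType) (m : nat) (lambda t : R) :
  0 < t < 1 -> admissible m.+3 lambda ->
  lambda * (p_ m.+3 t - m.+2%:R) <= m.+3%:R ^+ 2 * p_ m.+3 t.
Proof.
move=> /andP[t0 t1] [l0 /= adm].
have n0 : 0 < m.+3%:R :> R by rewrite ltr0n.
have d0 : 0 < m.+3%:R - m.+2%:R * t.
  rewrite subr_gt0 (@lt_le_trans _ _ m.+2%:R) ?ler_nat //.
  by rewrite -subr_gt0 -{1}[m.+2%:R]mulr1 -mulrBr mulr_gt0 ?subr_gt0 ?ltr0n.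
pose x (i : 'I_m.+3) := if i == ord0 then (m.+3%:R - m.+2%:R * t) / m.+3%:R else t / m.+3%:R.
have xa i : i != ord0 -> x i = t / m.+3%:R by rewrite /x => /negPf->.
have x0 : x ord0 = (m.+3%:R - m.+2%:R * t) / m.+3%:R by rewrite /x eqxx.
have xp i : 0 < x i by rewrite /x; case: ifP => _; rewrite divr_gt0.
have [Sx _ Px] := big_two_valued xa.
have xs : \sum_i x i = 1 by rewrite Sx x0; field; rewrite gt_eqF.
have P0 : 0 < \prod_i x i by apply: prodr_gt0.
(* Arithmetic-geometric mean at this point, needed for the sign of the
   denominator because lambda may be smaller than n^2. *)
have P1 : m.+3%:R ^+ m.+3 * \prod_i x i <= 1.
  have := weighted_sum_closed m.+2 t.
  rewrite -subr_ge0 Px x0 expr_div_n => E.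
  rewrite (_ : _ - _ = (1 - t) ^+ 2 * weighted_sum m.+2 t).
    by rewrite mulr_ge0 ?sqr_ge0 // ltW // weighted_sum_gt0 // ltW.
  rewrite E (exprS _ m.+2) (exprS t m.+2); field.
  by rewrite expf_neq0 gt_eqF.
have := adm x xp xs; rewrite subSS subSS subn0 ler_pdivrMr; last first.
  rewrite (_ : _ + _ = 1 - m.+3%:R ^+ m.+3 * \prod_i x i
      + m.+3%:R ^+ m.+1 * lambda * \prod_i x i).
    by rewrite ltr_wpDl ?subr_ge0 // !mulr_gt0 // exprn_gt0.
  by rewrite !exprS; ring.
rewrite -/(objective _ x) -subr_ge0 (objective_two_valued _ t0 d0 xa xs).
by rewrite pmulr_rge0 ?subr_ge0 // divr_gt0 ?exprn_gt0 ?subr_gt0 // mulr_gt0.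
Qed.

Theorem mainTheorem1 (R : realType) (n : nat) (hn : (3 <= n)%N) :
  exists t : R,
    [/\ t \in `[0, 1] /\ derive1 (p_ n) t = 0,
        forall s : R, s \in `[0, 1] -> derive1 (p_ n) s = 0 -> s = t,
        forall s : R, s \in `[0, 1] -> s != t -> p_ n s < p_ n t
      & is_best_constant n (n%:R ^+ 2 / (1 - (n%:R - 1) / p_ n t))].
Proof.
case: n hn => [|[|[|m]]] // _.
have [t t01 dt] := p_critical_point R m.
have /andP[t0 t1] := t01.
have pmax s : 0 <= s -> s != t -> p_ m.+3 s < p_ m.+3 t by exact: p_lt_critical.
have n0 : 0 < m.+3%:R :> R by rewrite ltr0n.
have c0 : 0 < m.+2%:R :> R by rewrite ltr0n.
have pc : m.+2%:R < p_ m.+3 t.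
  have := pmax 0 (lexx 0); rewrite lt_eqF // => /(_ isT).
  by have /eqP := p_sub m.+1 (0 : R); rewrite !mul0r subr_eq0 => /eqP ->.
have p0 := lt_trans c0 pc.
exists t; have -> : m.+3%:R - 1 = m.+2%:R :> R by rewrite -[m.+3%:R]natr1 addrK.
have -> : m.+3%:R ^+ 2 / (1 - m.+2%:R / p_ m.+3 t) =
    m.+3%:R ^+ 2 * p_ m.+3 t / (p_ m.+3 t - m.+2%:R).
  move: (_ ^+ 2) m.+2%:R (p_ _ t) pc p0 => N2 c p pc p0.
  by field; rewrite subr_eq0 !gt_eqF.
set lambda := _ / _.
have e0 : 0 < p_ m.+3 t - m.+2%:R by rewrite subr_gt0.
have ln : m.+3%:R ^+ 2 < lambda.
  by rewrite ltr_pdivlMr // ltr_pM2l ?exprn_gt0 // ltrBlDr ltrDl.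
split.
- by rewrite in_itv /= !ltW.
- move=> s; rewrite in_itv /= => /andP[s0 s1] ds.
  apply/eqP; apply/negPn/negP; rewrite neq_lt => /orP[] st.
  + by have := @p_derive_gt0 _ m _ _ s0 st; rewrite dt ds lexx ltxx => /(_ isT).
  + by have := @p_derive_gt0 _ m _ _ (ltW t0) st; rewrite dt ds lexx ltxx => /(_ isT).
- by move=> s; rewrite in_itv /= => /andP[s0 _]; exact: pmax.
split.
- have l0 : 0 < lambda by apply: lt_trans ln; rewrite exprn_gt0.
  split=> //= x xp xs; rewrite subSS subSS subn0 ler_pdivrMr.
    apply: objective_ge => // s /andP[s0 _].
    have ps : p_ m.+3 s <= p_ m.+3 t.
      by have [->//|st] := eqVneq s t; rewrite ltW // pmax // ltW.
    rewrite /lambda mulrAC ler_pdivrMr //; move: (p_ _ s) (p_ _ t) ps => u v uv.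
    move: (m.+3%:R ^+ 2) (exprn_gt0 2 n0) => N2 N20.
    rewrite -!mulrA ler_pM2l // -subr_ge0.
    have -> : u * (v - m.+2%:R) - v * (u - m.+2%:R) = m.+2%:R * (v - u) by ring.
    by rewrite mulr_ge0 ?subr_ge0.
  rewrite addr_gt0 // mulr_gt0 ?mulr_gt0 ?exprn_gt0 ?subr_gt0 //.
  exact: prodr_gt0.
- by move=> l /(admissible_le t01); rewrite ler_pdivlMr.
Qed.
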